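(* Let $\mathbf{A} \in \mathbb{R}^{M \times N}$, $\boldsymbol{\Psi} \in \mathbb{R}^{K \times N}$, $\mu > 0$, and let $\mathbf{W} = \operatorname{diag}(\mathbf{w}) \in \mathbb{R}^{K\times K}$, where $\mathbf{w} \in \mathbb{R}^K$ has strictly positive entries. Let $\mathbf{Q}_{\mu}^{\text{pr}} = \overline{\mathbf{A}}^T \overline{\mathbf{A}} + \mu \mathbf{I}_K$ with $\overline{\mathbf{A}} = \mathbf{A} (\mathbf{W} \boldsymbol{\Psi})_{\mathbf{A}}^\dagger$, where $(\mathbf{W} \boldsymbol{\Psi})_{\mathbf{A}}^\dagger = \mathbf{E} (\mathbf{W} \boldsymbol{\Psi})^\dagger$ is the oblique ($\mathbf{A}$-weighted) pseudoinverse of $\mathbf{W} \boldsymbol{\Psi}$, and let $R = \operatorname{rank}(\boldsymbol{\Psi})$. Then the first $R$ largest eigenvalues of $\mathbf{Q}_{\mu}^{\text{pr}}$ satisfy $$\mu \leq \lambda_i(\mathbf{Q}_{\mu}^{\text{pr}}) \leq \mu + \min\left\{ c_1 \lambda_i(\mathbf{A}^T \mathbf{A}),\; c_2 \lambda_i(\mathbf{W}^{-2}) \right\}$$ for $i = 1, \ldots, R$, where $c_1 = \lambda_1(\mathbf{W}^{-2})/\lambda_R(\boldsymbol{\Psi}^T \boldsymbol{\Psi})$ and $c_2 = \lambda_1(\mathbf{A}^T \mathbf{A})/\lambda_{R}(\boldsymbol{\Psi}^T \boldsymbol{\Psi})$ are constants independent of $i$. Moreover, the remaining $K-R$ eigenvalues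 of $\mathbf{Q}_{\mu}^{\text{pr}}$ are all equal to $\mu$.
   Context: For a square matrix $\mathbf{X}$ with real eigenvalues, $\lambda_i(\mathbf{X})$ denotes the $i$th largest eigenvalue of $\mathbf{X}$ in descending order, counting multiplicities. $\mathbf{X}^\dagger$ denotes the Moore–Penrose pseudoinverse. Let $P = \dim \ker(\boldsymbol{\Psi})$ and let $\mathbf{K} \in \mathbb{R}^{N \times P}$ (bold; not to be confused with the integer $K$) be a matrix whose columns form an orthonormal basis of $\ker(\boldsymbol{\Psi})$. Set $\mathbf{E} = \mathbf{I}_N - \mathbf{K}(\mathbf{A}\mathbf{K})^\dagger \mathbf{A} \in \mathbb{R}^{N\times N}$ (with $\mathbf{E} = \mathbf{I}_N$ if $\ker(\boldsymbol{\Psi}) = \{\mathbf{0}\}$). The oblique ($\mathbf{A}$-weighted) pseudoinverse of $\mathbf{W}\boldsymbol{\Psi}$ is $(\mathbf{W}\boldsymbol{\Psi})_{\mathbf{A}}^\dagger = \mathbf{E}(\mathbf{W}\boldsymbol{\Psi})^\dagger \in \mathbb{R}^{N \times K}$. (Note $\ker(\mathbf{W}\boldsymbol{\Psi}) = \ker(\boldsymbol{\Psi})$ because $\mathbf{W}$ is invertible.) The matrix $\boldsymbol{\Psi}$ is allowed to be rank-deficient. *)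

(* Defs.v *)
From HB Require Import structures.
From mathcomp Require Import all_boot all_order all_algebra.
From mathcomp Require Import polyrcf.
From mathcomp Require Export reals.

Set Implicit Arguments.
Unset Strict Implicit.
Unset Printing Implicit Defensive.

Import Order.TTheory GRing.Theory Num.Theory.
Local Open Scope ring_scope.

(* The real eigenvalues of X, each repeated according to its algebraic
   multiplicity, in descending order. *)
Definition eigenvalues (R : rcfType) (n : nat) (X : 'M[R]_n) : seq R :=
  sort >=%R
    (flatten [seq nseq (mup x (char_poly X)) x | x <- rootsR (char_poly X)]).

(* Indices start at 1: lambda 1 X is the largest eigenvalue. The value is the
   default 0 when i exceeds the number of real eigenvalues. *)
Definition lambda (R : rcfType) (n : nat) (i : nat) (X : 'M[R]_n) : R :=
  (eigenvalues X)`_i.-1.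

Lemma eigenvalues_split (R : rcfType) (n : nat) (X : 'M[R]_n) (s : seq R) :
  sorted >=%R s -> char_poly X = \prod_(a <- s) ('X - a%:P) ->
  eigenvalues X = s.
Proof.
move=> s_sorted Xs; have p0 : char_poly X != 0.
  by rewrite monic_neq0 ?char_poly_monic.
apply: (sorted_eq (leT := >=%R)) => //.
- by move=> x y z xy yz; apply: le_trans yz xy.
- by move=> x y /andP[xy yx]; apply/le_anti/andP.
- by apply: sort_sorted => x y; apply: le_total.
rewrite perm_sort; apply/allP => /= x _ /=; apply/eqP.
rewrite -(mu_prod_XsubC x s) -Xs count_flatten -map_comp sumnE big_map.
have uroots : uniq (rootsR (char_poly X)) by exact: uniq_roots.
have [rx|nrx] := boolP (x \in rootsR (char_poly X)).
  rewrite (bigD1_seq x) //= count_nseq /= eqxx mul1n big1 ?addn0 // => y yx.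
  by rewrite count_nseq /= (negbTE yx) mul0n.
rewrite mupNroot; last first.
  by have := roots_on_rootsR p0 => /(_ x); rewrite itv_boundlr /= => ->.
rewrite big1_seq // => y /andP[_ ry]; rewrite /= count_nseq /=.
by case: eqP => [yx|]; rewrite ?mul0n // -yx ry in nrx.
Qed.

(* The four Penrose equations. *)
Definition is_pinv (R : realFieldType) (m n : nat)
    (A : 'M[R]_(m, n)) (X : 'M[R]_(n, m)) : bool :=
  [&& A *m X *m A == A, X *m A *m X == X,
      (A *m X)^T == A *m X & (X *m A)^T == X *m A].

Lemma gram_row_free (R : realFieldType) (m n : nat) (B : 'M[R]_(m, n)) :
  row_free B -> B *m B^T \in unitmx.
Proof.
move=> fB; rewrite -row_free_unit -kermx_eq0; apply/eqP/row_matrixP => i.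
rewrite row0; set u := row i _.
have uBB : u *m (B *m B^T) = 0 by rewrite -row_mul mulmx_ker row0.
have : (u *m B) *m (u *m B)^T = 0.
  by rewrite trmx_mul !mulmxA -(mulmxA u) uBB mul0mx.
apply: contra_eq; rewrite -(mulmx_free_eq0 _ fB); move: (u *m B) => v v0.
apply: contra v0 => /eqP/matrixP/(_ 0 0); rewrite !mxE => /eqP.
rewrite psumr_eq0 => [/allP v0|j _]; last by rewrite mxE -expr2 sqr_ge0.
apply/eqP/rowP => j; rewrite mxE; apply/eqP.
by have := v0 j (mem_index_enum _); rewrite /= mxE -expr2 sqrf_eq0.
Qed.

Lemma pinv_exists (R : realFieldType) (m n : nat) (A : 'M[R]_(m, n)) :
  exists X, is_pinv A X.
Proof.
have [r [C [F [AE fC fF]]]] : exists r (C : 'M[R]_(m, r)) (F : 'M[R]_(r, n)),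
    [/\ A = C *m F, row_free C^T & row_free F].
  exists (\rank A), (col_base A), (row_base A); rewrite mulmx_base.
  by split; rewrite ?row_base_free // /row_free mxrank_tr; exact: col_base_full.
have uF : F *m F^T \in unitmx by exact: gram_row_free.
have uC : C^T *m C \in unitmx by have := gram_row_free fC; rewrite trmxK.
set G := invmx (F *m F^T); set H := invmx (C^T *m C).
have GT : G^T = G by rewrite trmx_inv trmx_mul trmxK.
have HT : H^T = H by rewrite trmx_inv trmx_mul trmxK.
pose X := F^T *m G *m (H *m C^T).
have AX : A *m X = C *m H *m C^T.
  by rewrite /X AE !mulmxA -(mulmxA C F) -(mulmxA C _ G) mulmxV // mulmx1.
have XA : X *m A = F^T *m G *m F.
  rewrite /X AE -!mulmxA; congr (_ *m (_ *m _)).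
  by rewrite (mulmxA C^T) mulmxA mulVmx // mul1mx.
exists X; apply/and4P; split; apply/eqP.
- by rewrite AX {1}AE !mulmxA -(mulmxA _ C^T C) -(mulmxA C H) mulVmx // mulmx1 AE.
- by rewrite XA /X !mulmxA -(mulmxA _ F F^T) -(mulmxA _ (F *m F^T) G) mulmxV ?mulmx1.
- by rewrite AX !trmx_mul trmxK HT mulmxA.
- by rewrite XA !trmx_mul trmxK GT mulmxA.
Qed.

Definition pinv (R : realFieldType) (m n : nat) (A : 'M[R]_(m, n)) :
  'M[R]_(n, m) := xchoose (pinv_exists A).

Lemma pinvP (R : realFieldType) (m n : nat) (A : 'M[R]_(m, n)) :
  is_pinv A (pinv A).
Proof. exact: xchooseP. Qed.

Lemma pinv_uniq (R : realFieldType) (m n : nat) (A : 'M[R]_(m, n)) X :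
  is_pinv A X -> X = pinv A.
Proof.
move: (pinv A) (pinvP A) => Y.
move=> /and4P[/eqP y1 /eqP y2 /eqP y3 /eqP y4] /and4P[/eqP x1 /eqP x2 /eqP x3 /eqP x4].
have AXY : A *m X = A *m Y.
  by rewrite -x3 -{1}y1 -(mulmxA (A *m Y)) trmx_mul x3 y3 mulmxA x1.
have XAY : X *m A = Y *m A.
  by rewrite -x4 -{1}y1 -(mulmxA A Y) mulmxA trmx_mul x4 y4 -mulmxA (mulmxA A) x1.
by rewrite -x2 XAY -mulmxA AXY mulmxA y2.
Qed.

(* The columns of Z form an orthonormal basis of the (column) null space of
   Psi; since kermx is a row kernel, this null space is the row space of
   kermx Psi^T. *)
Definition orthonormal_ker_basis (R : realFieldType) (k n p : nat)
    (Psi : 'M[R]_(k, n)) (Z : 'M[R]_(n, p)) : Prop :=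
  Z^T *m Z = 1%:M /\ (Z^T :=: kermx Psi^T)%MS.

(* E = I - Z (A Z)^+ A. When p = 0, the subtracted term is a product through a
   zero-dimensional space, so that E = I. *)
Definition oblique_proj (R : realFieldType) (m n p : nat)
    (A : 'M[R]_(m, n)) (Z : 'M[R]_(n, p)) : 'M[R]_n :=
  1%:M - Z *m pinv (A *m Z) *m A.

(* The A-weighted pseudoinverse of L, where the columns of Z are an orthonormal
   basis of the null space of L. *)
Definition oblique_pinv (R : realFieldType) (m n k p : nat)
    (A : 'M[R]_(m, n)) (Z : 'M[R]_(n, p)) (L : 'M[R]_(k, n)) : 'M[R]_(n, k) :=
  oblique_proj A Z *m pinv L.

(* Main.v *)
Require Import Defs.
From mathcomp Require Import all_boot all_order all_algebra.
From mathcomp Require Import sesquilinear spectral complex ring zify.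
Import Order.TTheory GRing.Theory Num.Theory.
Local Open Scope ring_scope.

Set Implicit Arguments.
Unset Strict Implicit.
Unset Printing Implicit Defensive.

(** Everything is a comparison of quadratic forms, turned into a comparison of
    eigenvalues by the Courant-Fischer principle. For a symmetric H the
    principle is used in two halves: lambda_i H <= c as soon as the form of H is
    at most c |x|^2 on a subspace cut out by fewer than i linear equations
    ([lambda_le_of_constraints]), and such a subspace exists for c = lambda_i H
    ([lambda_constraints]). Pulling the equations back along a linear map G then
    gives [lambda_compression_le]: for H' positive semidefinite, if the form of H
    at x is at most s times the form of H' at x G, and |x G|^2 <= t |x|^2, then
    lambda_i H <= s t lambda_i H'. Both halves rest on the real spectral theorem
    [symmetric_orthogonal_diag].

    Let L = W Psi, let X be its pseudoinverse, S = Abar^T Abar, r = rank Psi and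
    t = lambda_r (Psi^T Psi). Vectors are rows, so that the vector X x of the
    column convention is written x X^T.

    - Abar = (1 - Pi) A X where Pi = (A Z)(A Z)^+ is an orthogonal projection, so
      the form of S at x is at most |x X^T A^T|^2: the oblique correction can
      only decrease it ([sqnorm_oblique_le]).
    - x X^T lies in the row space of Psi, on which |y Psi^T|^2 >= t |y|^2
      ([lambda_rank_gram_le]), and x X^T Psi^T = x (L X) W^-1. Hence t |x X^T|^2
      is at most the form of W^-2 at x (L X) ([sqnorm_pinv_le]), where L X is an
      orthogonal projection.

    The c_1 bound is the compression lemma for G = X^T and H' = A^T A, with
    |x X^T|^2 <= c_1 |x|^2 by the second point. The c_2 bound is the compression
    lemma for G = L X and H' = W^-2, after bounding the form of A^T A by
    lambda_1 (A^T A). The lower bound holds because S is positive semidefinite,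
    and the eigenvalues of index larger than r equal mu because the form of S
    vanishes on the subspace x Abar^T = 0, whose codimension is at most r. *)

(** * Quadratic forms of row vectors *)

Definition sqnorm (R : realFieldType) (n : nat) (x : 'rV[R]_n) : R :=
  (x *m x^T) 0 0.

Definition qform (R : realFieldType) (n : nat) (H : 'M[R]_n) (x : 'rV[R]_n) :
  R := (x *m H *m x^T) 0 0.

Lemma sqnormE (R : realFieldType) n (x : 'rV[R]_n) :
  sqnorm x = \sum_j x 0 j ^+ 2.
Proof. by rewrite /sqnorm mxE; apply: eq_bigr => j _; rewrite mxE expr2. Qed.

Lemma sqnorm_ge0 (R : realFieldType) n (x : 'rV[R]_n) : 0 <= sqnorm x.
Proof. by rewrite sqnormE sumr_ge0 // => j _; rewrite sqr_ge0. Qed.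

Lemma sqnorm_eq0 (R : realFieldType) n (x : 'rV[R]_n) :
  (sqnorm x == 0) = (x == 0).
Proof.
rewrite sqnormE psumr_eq0 => [|j _]; last by rewrite sqr_ge0.
apply/allP/eqP => [x0|-> j _]; last by rewrite /= mxE expr0n.
apply/rowP => j; rewrite mxE; apply/eqP.
by have := x0 j (mem_index_enum _); rewrite /= sqrf_eq0.
Qed.

Lemma sqnorm_gt0 (R : realFieldType) n (x : 'rV[R]_n) :
  (0 < sqnorm x) = (x != 0).
Proof. by rewrite lt_def sqnorm_eq0 sqnorm_ge0 andbT. Qed.

Lemma sqnorm_orthogonal (R : realFieldType) n (O : 'M[R]_n) (x : 'rV[R]_n) :
  O *m O^T = 1%:M -> sqnorm (x *m O) = sqnorm x.
Proof.
by move=> OO; rewrite /sqnorm trmx_mul mulmxA -(mulmxA x) OO mulmx1.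
Qed.

Lemma qform_gram (R : realFieldType) m n (B : 'M[R]_(m, n)) x :
  qform (B^T *m B) x = sqnorm (x *m B^T).
Proof. by rewrite /qform /sqnorm trmx_mul trmxK !mulmxA. Qed.

Lemma qform_diag (R : realFieldType) n (d : 'rV[R]_n) x :
  qform (diag_mx d) x = \sum_j d 0 j * x 0 j ^+ 2.
Proof.
rewrite /qform mxE; apply: eq_bigr => j _.
by rewrite mul_mx_diag !mxE mulrAC mulrC.
Qed.

Lemma sqnormD_orthogonal (R : realFieldType) n (x y : 'rV[R]_n) :
  x *m y^T = 0 -> sqnorm (x + y) = sqnorm x + sqnorm y.
Proof.
move=> xy; have yx : y *m x^T = 0 by rewrite -[y]trmxK -trmx_mul xy trmx0.
rewrite /sqnorm linearD /= mulmxDl !mulmxDr xy yx addr0 add0r.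
by rewrite mxE.
Qed.

Lemma sqnormZ (R : realFieldType) n a (x : 'rV[R]_n) :
  sqnorm (a *: x) = a ^+ 2 * sqnorm x.
Proof.
by rewrite !sqnormE mulr_sumr; apply: eq_bigr => j _; rewrite mxE exprMn.
Qed.

Lemma qformD_scalar (R : realFieldType) n (H : 'M[R]_n) a x :
  qform (H + a%:M) x = qform H x + a * sqnorm x.
Proof.
by rewrite /qform /sqnorm mulmxDr mulmxDl mul_mx_scalar -scalemxAl !mxE.
Qed.

Lemma trmx_gram (R : realFieldType) m n (B : 'M[R]_(m, n)) :
  (B^T *m B)^T = B^T *m B.
Proof. by rewrite trmx_mul trmxK. Qed.

Lemma sqnorm_proj_le (R : realFieldType) n (P : 'M[R]_n) (x : 'rV[R]_n) :
  P^T = P -> P *m P = P -> sqnorm (x *m P) <= sqnorm x.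
Proof.
move=> Psym PP; rewrite -{2}(subrK (x *m P) x) sqnormD_orthogonal.
  by rewrite lerDr sqnorm_ge0.
by rewrite trmx_mul Psym mulmxA mulmxBl -mulmxA PP subrr mul0mx.
Qed.

(** * The real spectral theorem *)

(** Over the complex closure H is Hermitian, so its spectral diagonal is real,
    and having a given scalar as an eigenvalue does not depend on the field. *)
Lemma symmetric_eigenvalue (R : rcfType) n (H : 'M[R]_n.+1) :
  H^T = H -> exists a, eigenvalue H a.
Proof.
move=> Hsym; pose Hc := map_mx (real_complex R) H.
have herm : Hc \is hermsymmx.
  apply: realsym_hermsym.
    by apply/is_hermitianmxP; rewrite expr0 scale1r map_mx_id // map_trmx Hsym.
  by apply/mxOverP => i j; rewrite mxE; apply/complex_realP; exists (H i j).
have /orthomx_spectralP HcE := hermitian_normalmx herm.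
set U := spectralmx Hc in HcE; set d := spectral_diag Hc in HcE.
have uU : U \in unitmx := spectral_unit Hc.
have /mxOverP/(_ 0 0)/complex_realP[a da] := hermitian_spectral_diag_real herm.
exists a; rewrite -(eigenvalue_map (real_complex R)) -/Hc.
apply/eigenvalueP; exists (row 0 U); last first.
  apply: contraTneq uU => U0; rewrite unitmxE.
  rewrite (expand_det_row _ 0) big1 ?unitr0 // => j _.
  by have /rowP/(_ j) := U0; rewrite !mxE => ->; rewrite mul0r.
rewrite -row_mul HcE !mulmxA mulmxV // mul1mx row_mul row_diag_mx -scalemxAl.
by rewrite -rowE /= /d da.
Qed.

(** The Householder reflection exchanging u and the first basis vector. *)
Lemma orthogonal_with_row0 (R : realFieldType) n (u : 'rV[R]_n.+1) :
  sqnorm u = 1 -> exists2 O : 'M[R]_n.+1, O *m O^T = 1%:M & row 0 O = u.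
Proof.
move=> u1; pose e : 'rV[R]_n.+1 := delta_mx 0 0; pose v := u - e.
have [u0|/eqP vN0] := eqVneq v 0.
  exists 1%:M; first by rewrite trmx1 mulmx1.
  by rewrite row1; apply/eqP; rewrite eq_sym -subr_eq0 -/e -/v u0.
pose s := sqnorm v; have sN0 : s != 0 by rewrite sqnorm_eq0; apply/eqP.
pose O : 'M[R]_n.+1 := 1%:M - (2 / s) *: (v^T *m v).
have vv : v *m v^T = s%:M by rewrite [LHS]mx11_scalar.
have OT : O^T = O by rewrite linearB /= trmx1 linearZ /= trmx_mul trmxK.
exists O.
  rewrite OT mulmxBl mul1mx mulmxBr mulmx1 -scalemxAl -scalemxAr.
  rewrite mulmxA -(mulmxA _ v) vv mul_mx_scalar -scalemxAl scalerA scalerA.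
  by rewrite divfK // mulr_natr mulr2n scalerDl opprB !addrA addrK /O subrK.
(* Since |u| = 1 = |e|, |u - e|^2 = 2 - 2 u_0: this is why the reflection along
   u - e maps e to u. *)
have s_u : s = 2 * (1 - u 0 0).
  rewrite /s sqnormE (bigD1 0) //= !mxE eqxx.
  under eq_bigr => j j0 do rewrite !mxE (negbTE j0) andbF subr0.
  by move: u1; rewrite sqnormE (bigD1 0) //= => /(canRL (addKr _)) ->; ring.
have ev : e *m v^T = (- (s / 2))%:M.
  rewrite [LHS]mx11_scalar -rowE !mxE !eqxx s_u; congr (_%:M) => /=.
  by field.
rewrite rowE -/e mulmxBr mulmx1 -scalemxAr mulmxA ev mul_scalar_mx scalerA.
have -> : 2 / s * - (s / 2) = -1 by field.
by rewrite scaleN1r opprK addrC subrK.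
Qed.

(** Deflation: in an orthonormal basis starting with a unit eigenvector, the
    first row of H is a multiple of the first basis vector; by symmetry H is then
    block diagonal, with a symmetric lower right block. *)
Lemma symmetric_orthogonal_diag (R : rcfType) n (H : 'M[R]_n) : H^T = H ->
  exists (O : 'M[R]_n) (d : 'rV[R]_n),
    O *m O^T = 1%:M /\ H = O^T *m diag_mx d *m O.
Proof.
elim: n => [|n IHn] in H *.
  by exists 0, 0; split; apply/matrixP => - [].
move=> Hsym; have [a /eigenvalueP[u0 u0H u0N0]] := symmetric_eigenvalue Hsym.
have s0 : 0 < sqnorm u0 by rewrite sqnorm_gt0.
pose u := (Num.sqrt (sqnorm u0))^-1 *: u0.
have u1 : sqnorm u = 1.
  rewrite sqnormE; under eq_bigr => j _ do rewrite mxE exprMn.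
  by rewrite -mulr_sumr -sqnormE exprVn sqr_sqrtr ?ltW // mulVf ?gt_eqF.
have uH : u *m H = a *: u by rewrite -scalemxAl u0H scalerA mulrC -scalerA.
have [O OO Ou] := orthogonal_with_row0 u1.
have OTO : O^T *m O = 1%:M by exact: mulmx1C.
have [H1 H1def] : exists H1 : 'M[R]_(1 + n), H1 = O *m H *m O^T by eexists.
have H1sym : H1^T = H1 by rewrite H1def !trmx_mul trmxK Hsym mulmxA.
have H1row j : H1 0 j = a *+ (j == 0).
  have : row 0 H1 = a *: delta_mx 0 0.
    rewrite H1def !row_mul Ou uH -scalemxAl -Ou -row_mul OO.
    by rewrite row1.
  by move=> /rowP/(_ j); rewrite !mxE eqxx /= mulr_natr eq_sym.
have H1E : H1 = block_mx a%:M 0 0 (drsubmx H1).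
  rewrite -[LHS]submxK; congr block_mx.
  - by apply/matrixP => i j; rewrite !mxE !ord1 lshift0 H1row.
  - by apply/matrixP => i j; rewrite !mxE !ord1 lshift0 H1row.
  - by apply/matrixP => i j; rewrite !mxE !ord1 lshift0 -H1sym mxE H1row.
have [|O' [d' [OO' HE']]] := IHn (drsubmx H1).
  by rewrite -[in RHS]H1sym trmx_drsub.
pose V : 'M[R]_(1 + n) := block_mx 1%:M 0 0 O'.
have VV : V *m V^T = 1%:M.
  rewrite tr_block_mx mulmx_block !trmx0 !mulmx0 !mul0mx !addr0 add0r.
  by rewrite trmx1 mulmx1 OO' -scalar_mx_block.
pose D : 'rV[R]_(1 + n) := row_mx a%:M d'.
have VDV : V^T *m diag_mx D *m V = H1.
  rewrite H1E diag_mx_row tr_block_mx !trmx0 trmx1 !mulmx_block.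
  rewrite !mulmx0 !mul0mx !addr0 !add0r !mul0mx !mul1mx mulmx1 -HE'.
  by congr block_mx; apply/matrixP => i j; rewrite !ord1 !mxE.
exists (V *m O), D; split.
  by rewrite trmx_mul mulmxA -(mulmxA V) OO mulmx1.
have -> : H = O^T *m H1 *m O.
  by rewrite H1def !mulmxA OTO mul1mx -mulmxA OTO mulmx1.
by rewrite -VDV trmx_mul !mulmxA.
Qed.

Lemma eigenvalues_orthogonal_diag (R : rcfType) n (H O : 'M[R]_n)
    (d : 'rV[R]_n) :
  O *m O^T = 1%:M -> H = O^T *m diag_mx d *m O ->
  eigenvalues H = sort >=%R [seq d 0 j | j <- enum 'I_n].
Proof.
move=> OO HE; apply: eigenvalues_split.
  by apply: sort_sorted => x y; apply: le_total.
rewrite (perm_big [seq d 0 j | j <- enum 'I_n]) ?perm_sort //=.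
rewrite big_map enumT.
have -> : char_poly H = char_poly (diag_mx d).
  pose P := map_mx polyC O; have PP : P *m P^T = 1%:M.
    by rewrite /P map_trmx -map_mxM OO map_mx1.
  (* X - O^T D O = O^T (X - D) O over the polynomials. *)
  rewrite /char_poly /char_poly_mx HE !map_mxM -map_trmx.
  rewrite -[in LHS](mulmx1 'X%:M) -(mulmx1C PP) mulmxA -scalar_mxC.
  rewrite -mulmxBl -mulmxBr !det_mulmx mulrAC -det_mulmx (mulmx1C PP).
  by rewrite det1 mul1r.
rewrite char_poly_trig ?diag_mx_is_trig //.
by apply: eq_bigr => j _; rewrite mxE eqxx.
Qed.

(** * The Courant-Fischer principle *)

Lemma nth_sorted_nonincreasing (R : realDomainType) (s : seq R) i j :
  sorted >=%R s -> (i <= j < size s)%N -> s`_j <= s`_i.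
Proof.
move=> s_sorted /andP[ij j_s].
have ge_trans : transitive (>=%R : rel R).
  by move=> x y z xy yz; apply: le_trans yz xy.
apply: (sorted_leq_nth ge_trans (fun y => lexx y) 0 s_sorted) => //.
by rewrite inE (leq_ltn_trans ij).
Qed.

Lemma count_gt_nth_sorted (R : realDomainType) (s : seq R) i :
  sorted >=%R s -> (i < size s)%N -> (count (fun x => s`_i < x)%R s <= i)%N.
Proof.
move=> s_sorted i_s; rewrite -{2}(cat_take_drop i s) count_cat.
rewrite [X in (_ + X)%N](_ : _ = 0%N).
  by rewrite addn0 (leq_trans (count_size _ _)) // size_take i_s.
apply/eqP; rewrite -leqn0 leqNgt -has_count; apply/hasPn => x /(nthP 0)[j].
rewrite size_drop nth_drop => js <-; rewrite -leNgt.
by rewrite nth_sorted_nonincreasing // leq_addr -ltn_subRL.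
Qed.

Lemma nth_sorted_le (R : realDomainType) (s : seq R) i c :
  sorted >=%R s -> (i < size s)%N -> (count (fun x => c < x)%R s <= i)%N ->
  s`_i <= c.
Proof.
move=> s_sorted i_s; apply: contraTT; rewrite -ltNge -ltnNge => c_lt.
have all_gt : all (fun x => c < x) (take i.+1 s).
  apply/(all_nthP 0) => j; rewrite size_takel // => ji; rewrite nth_take //.
  apply: lt_le_trans c_lt _.
  by rewrite nth_sorted_nonincreasing // i_s andbT.
rewrite -(cat_take_drop i.+1 s) count_cat; apply: ltn_addr.
by move: all_gt; rewrite all_count size_takel // => /eqP ->.
Qed.

Lemma count_eigenvalues (R : rcfType) n (H O : 'M[R]_n) (d : 'rV[R]_n)
    (p : pred R) :
  O *m O^T = 1%:M -> H = O^T *m diag_mx d *m O ->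
  count p (eigenvalues H) = #|[set j | p (d 0 j)]|.
Proof.
move=> OO HE; rewrite (eigenvalues_orthogonal_diag OO HE).
rewrite (permP (_ : perm_eq _ [seq d 0 j | j <- enum 'I_n])) ?perm_sort //.
rewrite count_map -sum1_count -sum1_card big_enum_cond /=.
by apply: eq_bigl => j; rewrite inE.
Qed.

Lemma size_eigenvalues_symmetric (R : rcfType) n (H : 'M[R]_n) :
  H^T = H -> size (eigenvalues H) = n.
Proof.
move=> /symmetric_orthogonal_diag[O [d [OO HE]]].
by rewrite (eigenvalues_orthogonal_diag OO HE) size_sort size_map size_enum_ord.
Qed.

Lemma sorted_eigenvalues (R : rcfType) n (H : 'M[R]_n) :
  sorted >=%R (eigenvalues H).
Proof. by apply: sort_sorted => x y; apply: le_total. Qed.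

Lemma qform_orthogonal_diag (R : realFieldType) n (H O : 'M[R]_n)
    (d x : 'rV[R]_n) :
  H = O^T *m diag_mx d *m O ->
  qform H x = \sum_j d 0 j * (x *m O^T) 0 j ^+ 2.
Proof.
by move=> ->; rewrite -qform_diag /qform trmx_mul trmxK !mulmxA.
Qed.

(** The rows are the standard basis vectors indexed by J: right multiplication
    embeds R^J into R^n, and by the transpose restricts a vector to J. *)
Definition coord_incl (R : realFieldType) n (J : {set 'I_n}) :
  'M[R]_(#|J|, n) :=
  \matrix_(k, j) (enum_val k == j)%:R.

Lemma mul_coord_incl_tr (R : realFieldType) n (J : {set 'I_n}) (y : 'rV[R]_n) :
  y *m (coord_incl R J)^T = \row_k y 0 (enum_val k).
Proof.
apply/rowP => k; rewrite !mxE (bigD1 (enum_val k)) //= !mxE eqxx mulr1.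
rewrite big1 ?addr0 // => j jk.
by rewrite !mxE eq_sym (negbTE jk) mulr0.
Qed.

Lemma coord_incl_orthonormal (R : realFieldType) n (J : {set 'I_n}) :
  coord_incl R J *m (coord_incl R J)^T = 1%:M.
Proof.
apply/row_matrixP => k; rewrite row_mul mul_coord_incl_tr row1.
by apply/rowP => l; rewrite !mxE eqxx /= (inj_eq enum_val_inj) eq_sym.
Qed.

Lemma mul_coord_incl_out (R : realFieldType) n (J : {set 'I_n})
    (z : 'rV[R]_#|J|) j :
  j \notin J -> (z *m coord_incl R J) 0 j = 0.
Proof.
move=> jJ; rewrite mxE big1 // => k _; rewrite mxE.
case: eqP => [kj|_]; last by rewrite mulr0.
by rewrite -kj enum_valP in jJ.
Qed.

(** Otherwise at least i eigenvalues exceed c; the fewer than i equations x C = 0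
    have a nonzero solution in the span of the corresponding eigenvectors, and
    there the form of H is larger than c |x|^2. *)
Lemma lambda_le_of_constraints (R : rcfType) n k (H : 'M[R]_n)
    (C : 'M[R]_(n, k)) i c :
  H^T = H -> (\rank C < i <= n)%N ->
  (forall x, x *m C = 0 -> qform H x <= c * sqnorm x) -> lambda i H <= c.
Proof.
move=> Hsym /andP[rC i_n] formC.
have [O [d [OO HE]]] := symmetric_orthogonal_diag Hsym.
have i_gt0 : (0 < i)%N by exact: leq_trans rC.
apply: nth_sorted_le; rewrite ?sorted_eigenvalues //.
  by rewrite size_eigenvalues_symmetric // prednK.
rewrite (count_eigenvalues _ OO HE) leqNgt prednK //.
set J := [set j | _]; apply/negP => iJ.
have : kermx (coord_incl R J *m O *m C) != 0.
  rewrite kermx_eq0 /row_free; apply: contraTneq rC => rJ.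
  rewrite -leqNgt (leq_trans iJ) // -{1}rJ -mulmxA.
  by rewrite (leq_trans (mxrankM_maxr _ _)) // mxrankM_maxr.
case/rowV0Pn => z /sub_kermxP zC zN0.
(* The coordinates, in the eigenbasis, of the solution y O. *)
pose y := z *m coord_incl R J.
have yN0 : y != 0.
  apply: contraNneq zN0 => y0.
  by rewrite -(mulmx1 z) -(coord_incl_orthonormal R J) mulmxA -/y y0 mul0mx.
have yOC : y *m O *m C = 0 by rewrite /y -zC !mulmxA.
have := formC _ yOC.
rewrite sqnorm_orthogonal // (qform_orthogonal_diag _ HE).
rewrite -mulmxA OO mulmx1 sqnormE mulr_sumr leNgt => /negP[].
have term j : c * y 0 j ^+ 2 <= d 0 j * y 0 j ^+ 2.
  have [jJ|jJ] := boolP (j \in J); last first.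
    by rewrite mul_coord_incl_out // expr0n !mulr0.
  by rewrite ler_wpM2r ?sqr_ge0 //; move: jJ; rewrite inE => /ltW.
have /rV0Pn[j yj] := yN0.
rewrite (bigD1 j) //= [ltRHS](bigD1 j) //= ltr_leD //; last by apply: ler_sum.
rewrite ltr_pM2r ?exprn_even_gt0 //.
have : j \in J by apply: contraR yj => jJ; rewrite mul_coord_incl_out.
by rewrite inE.
Qed.

(** Orthogonality to the eigenvectors whose eigenvalue exceeds lambda_i H; there
    are fewer than i of them. *)
Lemma lambda_constraints (R : rcfType) n (H : 'M[R]_n) i :
  H^T = H -> (0 < i <= n)%N ->
  exists k (C : 'M[R]_(n, k)), (\rank C < i)%N /\
    forall x, x *m C = 0 -> qform H x <= lambda i H * sqnorm x.
Proof.
move=> Hsym /andP[i_gt0 i_n].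
have [O [d [OO HE]]] := symmetric_orthogonal_diag Hsym.
pose J := [set j | lambda i H < d 0 j].
exists #|J|, (O^T *m (coord_incl R J)^T); split.
  rewrite (leq_ltn_trans (rank_leq_col _)) // -(count_eigenvalues _ OO HE).
  rewrite -[X in (_ < X)%N]prednK // ltnS.
  rewrite count_gt_nth_sorted ?sorted_eigenvalues //.
  by rewrite size_eigenvalues_symmetric // prednK.
move=> x; rewrite mulmxA mul_coord_incl_tr (qform_orthogonal_diag _ HE).
have OTO : O^T *m O^T^T = 1%:M by rewrite trmxK; apply: mulmx1C.
rewrite -(sqnorm_orthogonal x OTO) sqnormE mulr_sumr => xJ.
apply: ler_sum => j _; have [jJ|] := boolP (j \in J).
  have /rowP/(_ (enum_rank_in jJ j)) := xJ.
  by rewrite !mxE enum_rankK_in // => ->; rewrite expr0n !mulr0.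
by rewrite inE -leNgt => ?; rewrite ler_wpM2r ?sqr_ge0.
Qed.

Lemma lambda_ge_of_form (R : rcfType) n (H : 'M[R]_n) i c :
  H^T = H -> (0 < i <= n)%N ->
  (forall x, c * sqnorm x <= qform H x) -> c <= lambda i H.
Proof.
move=> Hsym /andP[i_gt0 i_n] formc.
have [O [d [OO HE]]] := symmetric_orthogonal_diag Hsym.
have : lambda i H \in eigenvalues H.
  by rewrite mem_nth // size_eigenvalues_symmetric // prednK.
rewrite {1}(eigenvalues_orthogonal_diag OO HE) mem_sort => /mapP[j _ ->].
have := formc (delta_mx 0 j *m O); rewrite sqnorm_orthogonal //.
rewrite (qform_orthogonal_diag _ HE) -mulmxA OO mulmx1 sqnormE.
rewrite (bigD1 j) //= [leRHS](bigD1 j) //= !mxE !eqxx /= expr1n mulr1.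
rewrite !big1 ?addr0 ?mulr1 // => k kj;
  by rewrite mxE (negbTE kj) andbF expr0n ?mulr0.
Qed.

(** The equations defining a good subspace for H' pull back along G to no more
    equations for H. *)
Lemma lambda_compression_le (R : rcfType) n m (H : 'M[R]_n) (H' : 'M[R]_m)
    (G : 'M[R]_(n, m)) s t i :
  H^T = H -> H'^T = H' -> (0 < i <= n)%N -> (i <= m)%N -> 0 <= s ->
  (forall y, 0 <= qform H' y) ->
  (forall x, sqnorm (x *m G) <= t * sqnorm x) ->
  (forall x, qform H x <= s * qform H' (x *m G)) ->
  lambda i H <= s * t * lambda i H'.
Proof.
move=> Hsym H'sym /andP[i0 i_n] i_m s0 H'0 Gt HH'.
have i0m : (0 < i <= m)%N by rewrite i0.
have [k [C [rC formC]]] := lambda_constraints H'sym i0m.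
have l0 : 0 <= lambda i H'.
  by apply: lambda_ge_of_form => // x; rewrite mul0r.
apply: (@lambda_le_of_constraints _ _ _ _ (G *m C)) => //.
  by rewrite (leq_ltn_trans (mxrankM_maxr _ _)).
move=> x xGC; apply: le_trans (HH' x) _.
rewrite -!mulrA ler_wpM2l //.
apply: le_trans (formC _ _) _; first by rewrite -mulmxA.
by rewrite mulrCA ler_wpM2l.
Qed.

Lemma lambda_add_scalar_le (R : rcfType) n (H : 'M[R]_n) a i :
  H^T = H -> (0 < i <= n)%N -> lambda i (H + a%:M) <= a + lambda i H.
Proof.
move=> Hsym /[dup] i_n /andP[_ i_le].
have [k [C [rC formC]]] := lambda_constraints Hsym i_n.
apply: (@lambda_le_of_constraints _ _ _ _ C); rewrite ?rC //.
  by rewrite linearD /= Hsym tr_scalar_mx.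
by move=> x xC; rewrite qformD_scalar mulrDl addrC lerD2l formC.
Qed.

Lemma qform_le_lambda1 (R : rcfType) n (H : 'M[R]_n) x :
  H^T = H -> qform H x <= lambda 1 H * sqnorm x.
Proof.
move=> Hsym; have [n0|n0] := posnP n.
  rewrite [x](_ : _ = 0) /qform /sqnorm ?mul0mx ?mxE ?mulr0 //.
  by apply/rowP => j; have := ltn_ord j; rewrite {2}n0.
have [k [C [rC formC]]] := lambda_constraints Hsym (n0 : 0 < 1 <= n)%N.
apply: formC; rewrite [C](_ : _ = 0) ?mulmx0 //.
by apply/eqP; rewrite -mxrank_eq0 -leqn0 -ltnS.
Qed.

(** * The smallest nonzero eigenvalue of a Gram matrix *)

Lemma row_space_orthogonal_ker (R : realFieldType) m n p q (B : 'M[R]_(m, n))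
   (x : 'M[R]_(p, n)) (y : 'M[R]_(q, n)) :
  (x <= kermx B^T)%MS -> (y <= B)%MS -> x *m y^T = 0.
Proof.
by move=> /sub_kermxP xB /submxP[z ->]; rewrite trmx_mul mulmxA xB mul0mx.
Qed.

(** This bounds the eigenvalue from above by the Rayleigh quotient rho of y, so
    Courant-Fischer applies: on the span U of y and of the null space of B, which
    is orthogonal to y, the form of B^T B is at most rho |x|^2, and U has
    codimension less than rank B when y is nonzero. *)
Lemma lambda_rank_gram_le (R : rcfType) m n (B : 'M[R]_(m, n)) (y : 'rV[R]_n) :
  (y <= B)%MS ->
  lambda (\rank B) (B^T *m B) * sqnorm y <= sqnorm (y *m B^T).
Proof.
move=> yB; have [->|yN0] := eqVneq y 0.
  by rewrite mul0mx /sqnorm !mul0mx !mxE mulr0.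
have y_gt0 : 0 < sqnorm y by rewrite sqnorm_gt0.
rewrite -ler_pdivlMr //.
pose U := (kermx B^T + y)%MS.
have rU : (n - \rank B < \rank U)%N.
  rewrite -mxrank_tr -mxrank_ker rank_ltmx // ltmxE addsmxSl addsmx_sub.
  rewrite submx_refl /=; apply: contra yN0 => yker.
  by rewrite -sqnorm_eq0 /sqnorm (row_space_orthogonal_ker yker yB) mxE.
(* x cokermx U = 0 says exactly that x lies in U. *)
apply: (@lambda_le_of_constraints _ _ _ _ (cokermx U)).
- exact: trmx_gram.
- rewrite mxrank_coker rank_leq_col andbT.
  have := rank_leq_col U; have := rank_leq_col B; lia.
move=> x /eqP; rewrite -submxE => /sub_addsmxP[[u1 u2] /= xE].
pose k := u1 *m kermx B^T; pose a := u2 0 0.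
have kker : (k <= kermx B^T)%MS by rewrite submxMl.
have {xE} -> : x = k + a *: y.
  by rewrite xE [u2]mx11_scalar mul_scalar_mx.
rewrite sqnormD_orthogonal; last first.
  by rewrite linearZ /= -scalemxAr (row_space_orthogonal_ker kker yB) scaler0.
rewrite qform_gram mulmxDl (sub_kermxP kker) add0r -scalemxAl !sqnormZ.
rewrite mulrDr mulrCA divfK ?gt_eqF // lerDr.
by rewrite mulr_ge0 ?divr_ge0 ?sqnorm_ge0.
Qed.

(** Fewer than rank B equations have a nonzero solution in the row space of B,
    where the form of B^T B is positive; with the equations of
    [lambda_constraints] it is also at most lambda |x|^2. *)
Lemma lambda_rank_gram_gt0 (R : rcfType) m n (B : 'M[R]_(m, n)) :
  (0 < \rank B)%N -> 0 < lambda (\rank B) (B^T *m B).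
Proof.
move=> r0; have r_n := rank_leq_col B.
have r_bounds : (0 < \rank B <= n)%N by rewrite r0.
have [k [C [rC formC]]] := lambda_constraints (trmx_gram B) r_bounds.
have : (B :&: kermx C)%MS != 0.
  apply: contraTneq rC => BC0; rewrite -leqNgt.
  have := mxrank_disjoint_sum BC0; rewrite mxrank_ker.
  have := rank_leq_col (B + kermx C)%MS; have := rank_leq_row C; lia.
case/rowV0Pn => x; rewrite sub_capmx => /andP[xB /sub_kermxP xC] xN0.
have x_gt0 : 0 < sqnorm x by rewrite sqnorm_gt0.
rewrite -(pmulr_lgt0 _ x_gt0); apply: lt_le_trans (formC x xC).
rewrite qform_gram sqnorm_gt0; apply: contra xN0 => /eqP/sub_kermxP xker.
by rewrite -sqnorm_eq0 /sqnorm (row_space_orthogonal_ker xker xB) mxE.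
Qed.

(** * Pseudoinverses of weighted matrices *)

Lemma diag_mx_pos_unit (R : realFieldType) n (w : 'rV[R]_n) :
  (forall j, 0 < w 0 j) -> diag_mx w \in unitmx.
Proof.
move=> w_gt0; rewrite unitmxE det_diag unitfE.
by apply/prodf_neq0 => j _; rewrite gt_eqF.
Qed.

Lemma invmx_sqr_gram (R : realFieldType) n (W : 'M[R]_n) :
  W^T = W -> W \in unitmx -> invmx (W *m W) = (invmx W)^T *m invmx W.
Proof.
move=> Wsym uW; have uWW : W *m W \in unitmx by rewrite unitmx_mul uW.
rewrite trmx_inv Wsym -[RHS](mulKmx uWW) -!mulmxA mulKVmx //.
by rewrite mulmxV // mulmx1.
Qed.

(** With L = W B and X = L^+, the Penrose equations give X^T = X^T X L, so
    y = x X^T lies in the row space of B, and y B^T = x X^T L^T W^-1 =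
    x (L X) W^-1, whose squared norm is the right-hand side. *)
Lemma sqnorm_pinv_le (R : rcfType) k n (B : 'M[R]_(k, n)) (W : 'M[R]_k) x :
  W^T = W -> W \in unitmx ->
  lambda (\rank B) (B^T *m B) * sqnorm (x *m (pinv (W *m B))^T) <=
  qform (invmx (W *m W)) (x *m (W *m B *m pinv (W *m B))).
Proof.
move=> Wsym uW; have /and4P[_ /eqP + /eqP + /eqP] := pinvP (W *m B).
set X := pinv _ => XLX LXsym XLsym.
have XE : X^T = X^T *m X *m W *m B.
  by rewrite -[in LHS]XLX -XLsym !trmx_mul !trmxK !mulmxA.
apply: le_trans (lambda_rank_gram_le _) _.
  by rewrite XE !mulmxA submxMl.
rewrite invmx_sqr_gram // qform_gram trmx_inv Wsym.
by rewrite -LXsym !trmx_mul Wsym !mulmxA mulmxK.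
Qed.

Lemma rank_pinv_le (R : realFieldType) m n (L : 'M[R]_(m, n)) :
  (\rank (pinv L) <= \rank L)%N.
Proof.
have /and4P[_ /eqP XLX _ _] := pinvP L.
by rewrite -{1}XLX (leq_trans (mxrankM_maxl _ _)) // mxrankM_maxr.
Qed.

(** A E = (1 - (A Z)(A Z)^+) A, and 1 - (A Z)(A Z)^+ is an orthogonal
    projection. *)
Lemma sqnorm_oblique_le (R : realFieldType) m n p k (A : 'M[R]_(m, n))
    (Z : 'M[R]_(n, p)) (L : 'M[R]_(k, n)) x :
  sqnorm (x *m (A *m oblique_pinv A Z L)^T) <=
  sqnorm (x *m (pinv L)^T *m A^T).
Proof.
have /and4P[/eqP + _ /eqP + _] := pinvP (A *m Z).
set Y := pinv (A *m Z) => BYB BYsym.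
have -> : x *m (A *m oblique_pinv A Z L)^T =
    x *m (pinv L)^T *m A^T *m (1%:M - A *m Z *m Y).
  rewrite /oblique_pinv /oblique_proj -/Y.
  rewrite mulmxA mulmxBr mulmx1 !mulmxA -{1}(mul1mx A) -mulmxBl.
  by rewrite !trmx_mul linearB /= trmx1 BYsym !mulmxA.
apply: sqnorm_proj_le; first by rewrite linearB /= trmx1 BYsym.
by rewrite mulmxBl mul1mx mulmxBr mulmx1 mulmxA BYB subrr subr0.
Qed.

(** * Eigenvalue bounds *)

Theorem theorem4p3 (R : realType) (M N K P : nat)
    (A : 'M[R]_(M, N)) (Psi : 'M[R]_(K, N)) (mu : R) (w : 'rV[R]_K)
    (Z : 'M[R]_(N, P)) :
  0 < mu ->
  (forall j : 'I_K, 0 < w 0 j) ->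
  P = \rank (kermx Psi^T) ->
  orthonormal_ker_basis Psi Z ->
  let W : 'M[R]_K := diag_mx w in
  let W2inv : 'M[R]_K := invmx (W *m W) in
  let Abar : 'M[R]_(M, K) := A *m oblique_pinv A Z (W *m Psi) in
  let Q : 'M[R]_K := Abar^T *m Abar + mu%:M in
  let r : nat := \rank Psi in
  let c1 : R := lambda 1 W2inv / lambda r (Psi^T *m Psi) in
  let c2 : R := lambda 1 (A^T *m A) / lambda r (Psi^T *m Psi) in
  (forall i : nat, (1 <= i <= r)%N ->
     mu <= lambda i Q /\
     lambda i Q <=
       mu + Num.min (c1 * lambda i (A^T *m A)) (c2 * lambda i W2inv)) /\
  (forall i : nat, (r < i <= K)%N -> lambda i Q = mu).
Proof.
move=> _ w_gt0 _ _ W W2inv Abar Q r c1 c2.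
have Wsym : W^T = W by rewrite tr_diag_mx.
have uW : W \in unitmx by exact: diag_mx_pos_unit.
have Qsym : Q^T = Q by rewrite linearD /= trmx_gram tr_scalar_mx.
have qQ x : qform Q x = sqnorm (x *m Abar^T) + mu * sqnorm x.
  by rewrite qformD_scalar qform_gram.
have Q_ge i : (0 < i <= K)%N -> mu <= lambda i Q.
  move=> iK; apply: lambda_ge_of_form => // x.
  by rewrite qQ lerDr sqnorm_ge0.
split=> i; last first.
  move=> /andP[r_i iK]; apply/le_anti.
  rewrite Q_ge ?(leq_ltn_trans _ r_i) // andbT.
  apply: (@lambda_le_of_constraints _ _ _ _ Abar^T) => // [|x xA].
    rewrite iK andbT mxrank_tr (leq_ltn_trans _ r_i) //.
    rewrite (leq_trans (mxrankM_maxr _ _)) // (leq_trans (mxrankM_maxr _ _)) //.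
    by rewrite (leq_trans (rank_pinv_le _)) // mxrankM_maxr.
  by rewrite qQ xA /sqnorm mul0mx mxE add0r.
move=> /andP[i_gt0 i_r].
have iK : (0 < i <= K)%N by rewrite i_gt0 (leq_trans i_r) // rank_leq_row.
have iN : (i <= N)%N by rewrite (leq_trans i_r) // rank_leq_col.
split; first exact: Q_ge.
apply: le_trans (lambda_add_scalar_le mu (trmx_gram Abar) iK) _.
rewrite lerD2l le_min.
set X := pinv (W *m Psi); pose proj := W *m Psi *m X.
set t := lambda r (Psi^T *m Psi) in c1 c2 *.
have t_gt0 : 0 < t by rewrite lambda_rank_gram_gt0 // (leq_trans i_gt0).
have W2E : W2inv = (invmx W)^T *m invmx W by exact: invmx_sqr_gram.
have W2sym : W2inv^T = W2inv by rewrite W2E trmx_gram.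
have W2_ge0 y : 0 <= qform W2inv y by rewrite W2E qform_gram sqnorm_ge0.
have X_le x : sqnorm (x *m X^T) <= t^-1 * qform W2inv (x *m proj).
  by rewrite mulrC ler_pdivlMr // mulrC sqnorm_pinv_le.
have projsym : proj^T = proj by have /and4P[_ _ /eqP] := pinvP (W *m Psi).
have proj_le x : sqnorm (x *m proj) <= sqnorm x.
  have /and4P[/eqP LXL _ _ _] := pinvP (W *m Psi).
  by rewrite sqnorm_proj_le // /proj mulmxA LXL.
have lambda1_W2 : 0 <= lambda 1 W2inv.
  apply: lambda_ge_of_form => // [|x]; last by rewrite mul0r.
  by case/andP: iK => _; apply: leq_trans.
have lambda1_A : 0 <= lambda 1 (A^T *m A).
  apply: lambda_ge_of_form; first exact: trmx_gram.
    exact: leq_trans i_gt0 iN.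
  by move=> x; rewrite mul0r qform_gram sqnorm_ge0.
apply/andP; split.
  rewrite -[c1]mul1r.
  apply: (@lambda_compression_le _ _ _ _ _ X^T); rewrite ?trmx_gram //.
  - by move=> y; rewrite qform_gram sqnorm_ge0.
  - move=> x; apply: le_trans (X_le x) _.
    rewrite /c1 mulrAC [leRHS]mulrC ler_pM2l ?invr_gt0 //.
    apply: le_trans (qform_le_lambda1 _ W2sym) _.
    by rewrite ler_wpM2l.
  - by move=> x; rewrite mul1r !qform_gram sqnorm_oblique_le.
rewrite -[c2]mulr1.
apply: (@lambda_compression_le _ _ _ _ _ proj); rewrite ?trmx_gram //.
- by case/andP: iK.
- by rewrite divr_ge0 // ltW.
- by move=> x; rewrite mul1r.
- move=> x; rewrite qform_gram; apply: le_trans (sqnorm_oblique_le _ _ _ _) _.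
  rewrite -qform_gram; apply: le_trans (qform_le_lambda1 _ (trmx_gram A)) _.
  by rewrite /c2 -mulrA ler_wpM2l.
Qed.
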